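(* Let $f:\mathbb{R}^d\to\mathbb{R}$ be convex and Lipschitz-smooth with constant $L>0$, and suppose $\nabla f(x^\ast)=0$ for some $x^\ast$. Consider gradient descent $x_{k+1}=x_k-\alpha_k\nabla f(x_k)$, $k\ge0$, whose step-sizes $\alpha_k$ are chosen by adaptive backtracking (ABLS) for the Armijo condition with $c\in[1/2,1)$ and initial step-size $\alpha_{\mathrm{in}}>0$. Put $\overline\alpha=2(1-c)/L$. Then $\alpha_k\ge\min\{\alpha_{\mathrm{in}},\rho\overline\alpha\}$ for all $k\ge 0$, and for all $k\ge1$ $$f(x_k)-f(x^\ast)\le\frac{\|x_0-x^\ast\|^2}{2\min\{\alpha_{\mathrm{in}},\rho\overline\alpha\}\,k}.$$
   Context: A differentiable $f$ is Lipschitz-smooth with constant $L>0$ if $f(y)\le f(x)+\langle\nabla f(x),y-x\rangle+\frac L2\|y-x\|^2$ for all $x,y$. ABLS has parameters $c$ and $0<\epsilon<\rho<1$. At $x_k$ with direction $d_k=-\nabla f(x_k)$, the Armijo condition for $\alpha>0$ is $f(x_k+\alpha d_k)-f(x_k)\le c\,\alpha\langle\nabla f(x_k),d_k\rangle$; when $\nabla f(x_k)\ne0$ it is equivalent to $v(\alpha)\ge1$ with $v(\alpha)=\frac{f(x_k+\alpha d_k)-f(x_k)}{c\,\alpha\langle\nabla f(x_k),d_k\rangle}$ (it holds trivially when $\nabla f(x_k)=0$). ABLS at iteration $k$: start from an initial tentative $\alpha$; while the Armijo condition fails, set $\alpha\gets\hat\rho(v(\alpha))\,\alpha$, where $\hat\rho(v(\alpha))=\max\bigl(\epsilon,\rho\frac{1-c}{1-c\,v(\alpha)}\bigr)$;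 return $\alpha_k=\alpha$. The initial tentative step-size is $\alpha_{\mathrm{in}}$ at every iteration (memoryless), or $\alpha_{\mathrm{in}}$ at iteration $0$ and $\alpha_{k-1}$ at iteration $k\ge1$ (monotone). *)

(* Defs.v *)
From HB Require Import structures.
From mathcomp Require Import all_boot all_order all_algebra.
From mathcomp Require Import all_classical all_reals all_analysis.

Set Implicit Arguments.
Unset Strict Implicit.
Unset Printing Implicit Defensive.

Import Order.TTheory GRing.Theory Num.Theory.
Import numFieldNormedType.Exports.

Local Open Scope classical_set_scope.
Local Open Scope ring_scope.

(* The library norm on 'rV[R]_d is the sup norm.  It induces the usual
   topology, so it serves for differentiability; the inequalities below use
   the Euclidean norm. *)
Definition dotp {R : realType} {d : nat} (u v : 'rV[R]_d) : R :=
  \sum_(i < d) u 0 i * v 0 i.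

Definition enorm {R : realType} {d : nat} (u : 'rV[R]_d) : R :=
  Num.sqrt (dotp u u).

Definition grad {R : realType} {d : nat} (f : 'rV[R]_d -> R) (x : 'rV[R]_d) :
    'rV[R]_d :=
  \row_(i < d) 'D_(delta_mx 0 i) f x.

Definition lipschitz_smooth {R : realType} {d : nat} (L : R)
    (f : 'rV[R]_d -> R) : Prop :=
  (forall x, differentiable f x) /\
  (forall x y, f y <= f x + dotp (grad f x) (y - x)
                      + L / 2 * enorm (y - x) ^+ 2).

Definition armijo {R : realType} {d : nat} (f : 'rV[R]_d -> R) (c : R)
    (x dir : 'rV[R]_d) (a : R) : bool :=
  f (x + a *: dir) - f x <= c * a * dotp (grad f x) dir.

Definition armijo_ratio {R : realType} {d : nat} (f : 'rV[R]_d -> R) (c : R)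
    (x dir : 'rV[R]_d) (a : R) : R :=
  (f (x + a *: dir) - f x) / (c * a * dotp (grad f x) dir).

Definition rho_hat {R : realType} (c eps rho v : R) : R :=
  Num.max eps (rho * ((1 - c) / (1 - c * v))).

(* [abls_loop f c eps rho x dir a b]: the while loop, entered with tentative
   step-size [a], terminates and returns [b]. *)
Inductive abls_loop {R : realType} {d : nat} (f : 'rV[R]_d -> R)
    (c eps rho : R) (x dir : 'rV[R]_d) : R -> R -> Prop :=
| abls_accept (a : R) :
    armijo f c x dir a -> abls_loop f c eps rho x dir a a
| abls_backtrack (a b : R) :
    ~~ armijo f c x dir a ->
    abls_loop f c eps rho x dir
      (rho_hat c eps rho (armijo_ratio f c x dir a) * a) b ->
    abls_loop f c eps rho x dir a b.

(* The loop is deterministic, so this is the returned step-size whenever it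
   terminates.  The value 0 stands for non-termination; a positive lower bound
   on [abls] therefore also asserts termination. *)
Definition abls {R : realType} {d : nat} (f : 'rV[R]_d -> R) (c eps rho : R)
    (x dir : 'rV[R]_d) (a : R) : R :=
  xget 0 [set b | abls_loop f c eps rho x dir a b].

Variant initialization := Memoryless | Monotone.

Definition initial_step {R : realType} (init : initialization) (alpha_in : R)
    (alpha : nat -> R) (k : nat) : R :=
  match init, k with
  | Monotone, k'.+1 => alpha k'
  | _, _ => alpha_in
  end.

(* Main.v *)
(* A rejected step a satisfies a > 2(1-c)/L and, by smoothness,
   1 - c v(a) <= L a / 2, so the next tentative step is at least
   rho 2(1-c)/L, while it is smaller than a by at least a fixed amount; hence
   the search terminates above min(alpha_in, rho 2(1-c)/L).  Since c >= 1/2,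
   the Armijo condition and convexity give
   2 alpha_k (f(x_(k+1)) - f(xstar)) <= |x_k - xstar|^2 - |x_(k+1) - xstar|^2,
   which telescopes because f(x_k) is nonincreasing. *)
Require Import Defs.
From HB Require Import structures.
From mathcomp Require Import all_boot all_order all_algebra.
From mathcomp Require Import all_classical all_reals all_analysis.
From mathcomp Require Import ring lra.
Set Implicit Arguments.
Unset Strict Implicit.
Unset Printing Implicit Defensive.
Import Order.TTheory GRing.Theory Num.Theory.
Import numFieldNormedType.Exports.
Local Open Scope classical_set_scope.
Local Open Scope ring_scope.

Section Euclidean.
Context {R : realType} {d : nat}.
Implicit Types (a : R) (u v w : 'rV[R]_d).

Lemma dotpC u v : dotp u v = dotp v u.
Proof. by apply: eq_bigr => i _; rewrite mulrC. Qed.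

Lemma dotpDr u v w : dotp u (v + w) = dotp u v + dotp u w.
Proof. by rewrite -big_split; apply: eq_bigr => i _; rewrite mxE mulrDr. Qed.

Lemma dotpZr a u v : dotp u (a *: v) = a * dotp u v.
Proof. by rewrite mulr_sumr; apply: eq_bigr => i _; rewrite mxE mulrCA. Qed.

Lemma dotpNr u v : dotp u (- v) = - dotp u v.
Proof. by rewrite -scaleN1r dotpZr mulN1r. Qed.

Lemma dotp_ge0 u : 0 <= dotp u u.
Proof. by apply: sumr_ge0 => i _; rewrite -expr2 sqr_ge0. Qed.

Lemma enorm_sqr u : enorm u ^+ 2 = dotp u u.
Proof. by rewrite /enorm sqr_sqrtr ?dotp_ge0. Qed.

Lemma enorm_sqrN u : enorm (- u) ^+ 2 = enorm u ^+ 2.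
Proof. by rewrite !enorm_sqr dotpNr dotpC dotpNr opprK. Qed.

Lemma enorm_sqrZ a u : enorm (a *: u) ^+ 2 = a ^+ 2 * enorm u ^+ 2.
Proof. by rewrite !enorm_sqr dotpZr dotpC dotpZr mulrA expr2. Qed.

Lemma enorm_sqrB u v :
  enorm (u - v) ^+ 2 = enorm u ^+ 2 - 2 * dotp u v + enorm v ^+ 2.
Proof.
by rewrite !enorm_sqr dotpDr dotpNr !(dotpC (u - v)) !dotpDr !dotpNr
  (dotpC v u); ring.
Qed.

End Euclidean.

Section Smooth.
Context {R : realType} {d : nat} (f : 'rV[R]_d -> R) (L : R).
Hypothesis f_smooth : lipschitz_smooth L f.
Implicit Types (x y h : 'rV[R]_d) (a : R).

Lemma smooth_le x h :
  f (x + h) <= f x + dotp (grad f x) h + L / 2 * enorm h ^+ 2.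
Proof. by have := f_smooth.2 x (x + h); rewrite [x + h]addrC addrK [h + x]addrC. Qed.

Lemma smooth_descent x a :
  f (x + a *: - grad f x) <=
  f x - a * enorm (grad f x) ^+ 2 + L / 2 * (a ^+ 2 * enorm (grad f x) ^+ 2).
Proof.
have := smooth_le x (a *: - grad f x).
by rewrite dotpZr dotpNr -enorm_sqr mulrN enorm_sqrZ enorm_sqrN.
Qed.

Hypothesis f_convex : convex_function [set: 'rV[R]_d] f.

Lemma convex_functionP x y (t : R) : 0 <= t <= 1 ->
  f (t *: x + (1 - t) *: y) <= t * f x + (1 - t) * f y.
Proof.
move=> /andP[t_ge0 t_le1].
by have := f_convex (Itv01 t_ge0 t_le1) (in_setT x) (in_setT y).
Qed.

(* Midpoint convexity turns the quadratic upper bound into a lower one. *)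
Lemma convex_smooth_ge x h :
  f x + dotp (grad f x) h - L / 2 * enorm h ^+ 2 <= f (x + h).
Proof.
have half01 : 0 <= (1 / 2 : R) <= 1 by lra.
have := convex_functionP (x + h) (x - h) half01.
rewrite (_ : 1 - 1 / 2 = 1 / 2 :> R); last by field.
rewrite -scalerDr addrACA subrr addr0 scalerDr -scalerDl -mulrDl mulfV//.
rewrite scale1r.
have := smooth_le x (- h); rewrite dotpNr enorm_sqrN.
lra.
Qed.

(** At x + t(y - x), convexity bounds f above by the chord and [convex_smooth_ge] bounds it below;
    dividing by t leaves an error linear in t, which vanishes as t tends to 0. *)
Lemma convex_grad_le x y : f x + dotp (grad f x) (y - x) <= f y.
Proof.
suff small t : 0 < t -> t <= 1 ->
    dotp (grad f x) (y - x) - t * (L / 2 * enorm (y - x) ^+ 2) <= f y - f x.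
  rewrite addrC -lerBrDr.
  set q := L / 2 * _ in small; set D := dotp _ _ in small *.
  (* The sign of [L] is open here. If [q] <= 0 then t = 1 suffices; otherwise t = min(1, e/q) keeps
     the error t [q] at most [e]. *)
  have [q_le0|q_gt0] := leP q 0.
    by have := small 1 ltr01 (lexx _); lra.
  apply/ler_addgt0Pr => e e_gt0.
  have t_gt0 : 0 < Num.min 1 (e / q) by rewrite lt_min ltr01 divr_gt0.
  have := small _ t_gt0; rewrite ge_min lexx => /(_ isT).
  have : Num.min 1 (e / q) * q <= e by rewrite -ler_pdivlMr// ge_min lexx orbT.
  lra.
move=> t_gt0 t_le1.
have t01 : 0 <= t <= 1 by rewrite ltW.
have := convex_functionP y x t01.
rewrite (_ : t *: y + (1 - t) *: x = x + t *: (y - x)); last first.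
  by rewrite scalerBl scale1r scalerBr addrCA.
have := convex_smooth_ge x (t *: (y - x)); rewrite dotpZr enorm_sqrZ => lo hi.
rewrite -(ler_pM2l t_gt0).
have := le_trans lo hi; lra.
Qed.

End Smooth.

Section Backtracking.
Context {R : realType} {d : nat} (f : 'rV[R]_d -> R) (L c eps rho : R).
Hypotheses (L_gt0 : 0 < L) (f_smooth : lipschitz_smooth L f).
Hypotheses (c_gt0 : 0 < c) (c_lt1 : c < 1).
Hypotheses (eps_gt0 : 0 < eps) (eps_lt_rho : eps < rho) (rho_lt1 : rho < 1).
Variable x : 'rV[R]_d.
Implicit Types a b : R.

Let g := grad f x.
Let alpha_bar := 2 * (1 - c) / L.
Let next a := rho_hat c eps rho (armijo_ratio f c x (- g) a) * a.

Lemma armijoE a :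
  armijo f c x (- g) a = (f (x + a *: - g) <= f x - c * a * enorm g ^+ 2).
Proof. by rewrite /armijo dotpNr -enorm_sqr mulrN lerBlDl. Qed.

Lemma armijo_reject a : 0 < a -> ~~ armijo f c x (- g) a ->
  [/\ alpha_bar < a, rho * alpha_bar <= next a & next a <= rho * a].
Proof.
move=> a_gt0; rewrite armijoE -ltNge => rej.
have up := smooth_descent f_smooth x a; rewrite -/g in up.
(* At a zero gradient smoothness gives f(x + a d) <= f(x), so the Armijo test would pass. Rejection
   thus makes the denominator of [armijo_ratio] nonzero. *)
have G_gt0 : 0 < enorm g ^+ 2.
  rewrite lt_neqAle sqr_ge0 andbT eq_sym; apply: contraTneq rej => G0.
  by move: up; rewrite G0 !mulr0 subr0 addr0 -leNgt.
have aG_gt0 : 0 < a * enorm g ^+ 2 by rewrite mulr_gt0.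
pose v := armijo_ratio f c x (- g) a.
have cvE : c * v * (a * enorm g ^+ 2) = f x - f (x + a *: - g).
  rewrite /v /armijo_ratio dotpNr -enorm_sqr; field.
  by rewrite -sqrf_eq0 !gt_eqF.
(* After scaling by a |g|^2, this bound is the rejection itself, and the next one, [v_ge], is the
   smoothness bound. *)
have v_lt1 : c * v < c.
  by rewrite -(ltr_pM2r aG_gt0) cvE; lra.
have v_ge : 1 - c * v <= L * a / 2.
  by rewrite -(ler_pM2r aG_gt0) mulrBl cvE mul1r; lra.
have ab_lt : alpha_bar < a by rewrite /alpha_bar ltr_pdivrMr//; lra.
have den_gt0 : 0 < 1 - c * v by rewrite subr_gt0 (lt_trans v_lt1).
have rho_gt0 : 0 < rho by apply: lt_trans eps_lt_rho.
split => //; rewrite /next -/v /rho_hat.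
  apply: (@le_trans _ _ (rho * ((1 - c) / (1 - c * v)) * a)).
    rewrite -mulrA ler_pM2l// /alpha_bar ler_pdivrMr// mulrAC -mulrA mulrAC.
    rewrite mulrA ler_pdivlMr//.
    have : (1 - c) * (1 - c * v) <= (1 - c) * (L * a / 2).
      by rewrite ler_pM2l ?subr_gt0.
    lra.
  by rewrite ler_pM2r// le_max lexx orbT.
(* Both arguments of the maximum are at most [rho]: [eps] by hypothesis, the other because c v < c
   gives (1 - c)/(1 - c v) <= 1. *)
rewrite ler_pM2r// ge_max (ltW eps_lt_rho) /= ger_pMr// ler_pdivrMr//.
lra.
Qed.

Lemma next_gt0 a : 0 < a -> 0 < next a.
Proof. by move=> a_gt0; rewrite mulr_gt0// lt_max eps_gt0. Qed.

Lemma abls_loop_armijo a b :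
  abls_loop f c eps rho x (- g) a b -> armijo f c x (- g) b.
Proof. by elim. Qed.

(** Induction on the run: after a rejection the new tentative step is already at least
    [rho * alpha_bar], so the minimum for it is no smaller than the minimum for [a]. *)
Lemma abls_loop_ge a b : abls_loop f c eps rho x (- g) a b ->
  0 < a -> Num.min a (rho * alpha_bar) <= b.
Proof.
elim=> {a b} [a _ _|a b rej _ IH a_gt0]; first by rewrite ge_min lexx.
have [_ next_ge _] := armijo_reject a_gt0 rej.
apply: le_trans (IH (next_gt0 a_gt0)).
by rewrite le_min !ge_min next_ge lexx !orbT.
Qed.

(** A rejected [a] exceeds [alpha_bar] and its successor is at most [rho * a], so each rejection
    costs at least [delta]. The induction is on a bound [n] for a / [delta]. *)
Lemma abls_loop_ex a : 0 < a -> exists b, abls_loop f c eps rho x (- g) a b.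
Proof.
pose delta := (1 - rho) * alpha_bar.
have delta_gt0 : 0 < delta.
  by rewrite !mulr_gt0 ?invr_gt0 ?subr_gt0 ?ltr0n.
have [n] : exists n : nat, a <= delta * n%:R.
  exists (Num.truncn (a / delta)).+1; rewrite mulrC -ler_pdivrMr//.
  exact/ltW/truncnS_gt.
elim: n a => [|n IH] a a_le a_gt0.
  by move: a_le; rewrite mulr0 leNgt a_gt0.
have [acc|rej] := boolP (armijo f c x (- g) a).
  by exists a; constructor.
have [ab_lt _ next_le] := armijo_reject a_gt0 rej.
have [||b loop_b] := IH (next a); last by exists b; apply: abls_backtrack.
  have : delta <= (1 - rho) * a by rewrite ler_pM2l ?subr_gt0// ltW.
  by move: a_le; rewrite -natr1; lra.
exact: next_gt0.
Qed.

Lemma ablsP a : 0 < a ->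
  abls_loop f c eps rho x (- g) a (abls f c eps rho x (- g) a).
Proof. by move=> /abls_loop_ex; apply: xgetPex. Qed.

End Backtracking.

(* For c >= 1/2 the Armijo decrease dominates the quadratic term
   a |grad f x|^2 / 2 of the expansion of |y - xstar|^2. *)
Lemma armijo_gradient_step (R : realType) (d : nat) (f : 'rV[R]_d -> R)
    (L c a : R) (x xstar : 'rV[R]_d) :
  convex_function [set: 'rV[R]_d] f -> lipschitz_smooth L f ->
  1 / 2 <= c -> 0 < a -> armijo f c x (- grad f x) a ->
  let y := x - a *: grad f x in
  f y <= f x /\
  2 * a * (f y - f xstar) <= enorm (x - xstar) ^+ 2 - enorm (y - xstar) ^+ 2.
Proof.
move=> f_convex f_smooth c_ge a_gt0; rewrite armijoE scalerN => acc y.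
set g := grad f x in acc y *; rewrite -/y in acc.
have aG_ge0 : 0 <= a * enorm g ^+ 2 by rewrite mulr_ge0 ?sqr_ge0// ltW.
have half_le : 1 / 2 * (a * enorm g ^+ 2) <= c * a * enorm g ^+ 2.
  by rewrite -(mulrA c) ler_wpM2r.
split; first by lra.
have := convex_grad_le f_smooth f_convex x xstar; rewrite -/g => cvx.
rewrite (_ : y - xstar = x - xstar - a *: g); last by rewrite /y addrAC.
rewrite (enorm_sqrB (x - xstar)) dotpZr enorm_sqrZ (dotpC _ g).
move: cvx; rewrite -(opprB x) dotpNr => cvx.
(* Armijo decrease plus the gradient inequality at [x]. Multiplied by 2a, the right side is exactly
   |x - xstar|^2 - |y - xstar|^2. *)
have step : f y - f xstar <= dotp g (x - xstar) - 1 / 2 * (a * enorm g ^+ 2).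
  by lra.
have : 2 * a * (f y - f xstar) <=
    2 * a * (dotp g (x - xstar) - 1 / 2 * (a * enorm g ^+ 2)).
  by rewrite ler_pM2l ?mulr_gt0.
lra.
Qed.

Theorem proposition13 (R : realType) (d : nat) (f : 'rV[R]_d -> R)
    (L : R) (xstar : 'rV[R]_d)
    (c eps rho alpha_in : R) (init : initialization)
    (x : nat -> 'rV[R]_d) (alpha : nat -> R)
    (L_gt0 : 0 < L)
    (f_convex : convex_function [set: 'rV[R]_d] f)
    (f_smooth : lipschitz_smooth L f)
    (grad_xstar : grad f xstar = 0)
    (c_ge : 1 / 2 <= c) (c_lt1 : c < 1)
    (eps_gt0 : 0 < eps) (eps_lt_rho : eps < rho) (rho_lt1 : rho < 1)
    (alpha_in_gt0 : 0 < alpha_in)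
    (x_rec : forall k : nat, x k.+1 = x k - alpha k *: grad f (x k))
    (alpha_abls : forall k : nat,
       alpha k = abls f c eps rho (x k) (- grad f (x k))
                   (initial_step init alpha_in alpha k)) :
  let alpha_bar := 2 * (1 - c) / L in
  (forall k : nat, Num.min alpha_in (rho * alpha_bar) <= alpha k) /\
  (forall k : nat, (1 <= k)%N ->
     f (x k) - f xstar <=
     enorm (x 0%N - xstar) ^+ 2
       / (2 * Num.min alpha_in (rho * alpha_bar) * k%:R)).
Proof.
move=> alpha_bar; set m := Num.min _ _.
have c_gt0 : 0 < c by lra.
have m_gt0 : 0 < m.
  rewrite lt_min alpha_in_gt0 /= mulr_gt0 ?(lt_trans eps_gt0 eps_lt_rho)//.
  by rewrite !mulr_gt0 ?invr_gt0 ?subr_gt0.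
have abls_ge k a : m <= a -> m <= abls f c eps rho (x k) (- grad f (x k)) a.
  move=> m_le; have a_gt0 := lt_le_trans m_gt0 m_le.
  have loop := ablsP L_gt0 f_smooth c_gt0 c_lt1 eps_gt0 eps_lt_rho rho_lt1
    (x k) a_gt0.
  apply: le_trans (abls_loop_ge L_gt0 f_smooth c_gt0 c_lt1 eps_gt0 eps_lt_rho
    loop a_gt0).
  by rewrite le_min m_le ge_min lexx orbT.
have m_le_in : m <= alpha_in by rewrite ge_min lexx.
(* In the monotone mode the floor [m] is inherited: the previous returned step, itself at least [m],
   starts the next search. *)
have init_ge k : m <= initial_step init alpha_in alpha k.
  elim: k => [|k /(abls_ge k)]; first by case: (init).
  by rewrite -alpha_abls; case: (init).
have alpha_ge k : m <= alpha k by rewrite alpha_abls abls_ge.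
split=> // k k_ge1.
(* Nonnegativity of the gap allows [alpha j] to be replaced by the smaller [m] in the telescoping
   inequality. *)
have gap_ge0 y : f xstar <= f y.
  have := convex_grad_le f_smooth f_convex xstar y.
  rewrite grad_xstar /dotp big1 ?addr0// => i _.
  by rewrite mxE mul0r.
have step j : f (x j.+1) <= f (x j) /\
    2 * m * (f (x j.+1) - f xstar) <=
    enorm (x j - xstar) ^+ 2 - enorm (x j.+1 - xstar) ^+ 2.
  have aj_gt0 := lt_le_trans m_gt0 (alpha_ge j).
  have acc : armijo f c (x j) (- grad f (x j)) (alpha j).
    rewrite alpha_abls; apply/abls_loop_armijo/(ablsP L_gt0) => //.
    exact: lt_le_trans (init_ge j).
  have [] := armijo_gradient_step xstar f_convex f_smooth c_ge aj_gt0 acc.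
  rewrite -x_rec => dec tele; split=> //; apply: le_trans tele.
  by rewrite ler_wpM2r ?subr_ge0// ler_pM2l.
(* The left side is a Lyapunov function, nonincreasing in [n]: descent carries the weight 2mn from
   x_n to x_(n+1), and the drop in squared distance pays for the extra 2m. *)
have potential n : 2 * m * n%:R * (f (x n) - f xstar)
    + enorm (x n - xstar) ^+ 2 <= enorm (x 0%N - xstar) ^+ 2.
  elim: n => [|n IH]; first by rewrite mulr0 mul0r add0r.
  have [dec tele] := step n.
  have : 2 * m * n%:R * (f (x n.+1) - f xstar) <=
      2 * m * n%:R * (f (x n) - f xstar).
    by rewrite ler_wpM2l ?lerB// !mulr_ge0// ltW.
  rewrite -natr1; lra.
rewrite ler_pdivlMr; last by rewrite !mulr_gt0 ?ltr0n.
have := potential k; have := sqr_ge0 (enorm (x k - xstar)); lra.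
Qed.
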